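(* Let $n\ge1$, $n'=\lfloor n/2\rfloor$. Then $R_n$ is a free $R_n^{odd}$-module with basis $\{h_{2i_1}h_{2i_2}\cdots h_{2i_{n'}}\mid 0\le i_1\le i_2\le\dots\le i_{n'}\}$: $$R_n=\bigoplus_{0\le i_1\le\dots\le i_{n'}}R_n^{odd}\,h_{2i_1}\cdots h_{2i_{n'}}.$$
   Context: $R_n=\mathbb C[x_1,\dots,x_n]^{S_n}$ is the ring of symmetric polynomials. $p_k=\sum_{j=1}^nx_j^k$ are power sums, $h_k$ the complete homogeneous symmetric polynomials in $x_1,\dots,x_n$ ($h_0=1$). $R_n^{odd}=\mathbb C[p_{2j+1}\mid 0\le j\le (n-1)/2]\subset R_n$. *)

(* Defs.v *)
(* with multinomials (mpoly) and the real-closed [complex]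
   construction: the field C is modelled as [R[i]] for an arbitrary
   [R : realType] (a complete archimedean ordered field, i.e. the reals). *)
From mathcomp Require Import all_boot all_algebra.
From mathcomp Require Import reals.
From mathcomp.real_closed Require Import complex.
From mathcomp Require Import mpoly.

Set Implicit Arguments.
Unset Strict Implicit.
Unset Printing Implicit Defensive.

Import GRing.Theory.
Local Open Scope ring_scope.

Section SymDefs.
Variables (F : fieldType) (n : nat).

Definition psum (k : nat) : {mpoly F[n]} := \sum_(i < n) 'X_i ^+ k.

Definition hcomp (k : nat) : {mpoly F[n]} :=
  \sum_(m : 'X_{1..n < k.+1} | mdeg (val m) == k) 'X_[val m].

(* number of odd power sums p_1, p_3, ..., p_{2j+1} with 0 <= j <= (n-1)/2 *)
Definition nodd : nat := (n.+1)./2.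

Definition odd_psums : nodd.-tuple {mpoly F[n]} :=
  [tuple psum (2 * j).+1 | j < nodd].

Definition Rodd (q : {mpoly F[n]}) : Prop :=
  exists Q : {mpoly F[nodd]}, q = Q \mPo odd_psums.

Definition basis_index (I : seq nat) : bool :=
  (size I == n./2) && sorted leq I.

Definition hbasis (I : seq nat) : {mpoly F[n]} :=
  \prod_(i <- I) hcomp (2 * i).

End SymDefs.

(* Main.v *)
Require Import Defs.
From mathcomp Require Import all_boot all_algebra all_fingroup.
From mathcomp Require boolp.
From mathcomp Require Import reals.
From mathcomp.real_closed Require Import complex.
From mathcomp Require Import ring zify mpoly.

Set Implicit Arguments.
Unset Strict Implicit.
Unset Printing Implicit Defensive.

Import GRing.Theory.
Local Open Scope ring_scope.

(* Modulo the odd power sums, the ring R_n of symmetric polynomials is generated by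
   the even elementary polynomials e_2, ..., e_(2m), m = n./2, and becomes the ring
   of symmetric polynomials in m variables, h_(2i) playing the role of h_i. There
   the Jacobi-Trudi expansion writes everything in terms of m-fold products of the
   h_i, so by induction on the degree the h_(2i_1) ... h_(2i_m) span R_n over the
   odd power sums. Linear independence is a counting argument: conjugation of
   partitions gives a degree-preserving bijection between the exponents of the
   monomials in e_1, ..., e_n and the spanning terms
   p_1^(g_0) p_3^(g_1) ... h_(2i_1) ... h_(2i_m), and the former are free. *)

(** * Generating-function identities for e_k, h_k and p_k *)

Lemma geometric_sum_factor (A : comNzRingType) (c : A) (k : nat) :
  (\sum_(a < k.+1) (c ^+ a)%:P * 'X^a) * (1 - c%:P * 'X) =
  1 - (c ^+ k.+1)%:P * 'X^(k.+1).
Proof.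
rewrite mulrC polyC_exp -exprMn -[X in _ = X - _](expr1n _ k.+1) subrXX.
congr (_ * _); apply: eq_bigr => a _.
by rewrite expr1n mul1r exprMn polyC_exp.
Qed.

Section SymmetricIdentities.
Variables (F : fieldType) (n : nat).
Local Notation MP := {mpoly F[n]}.
Local Notation e := (mesym n F).
Local Notation h := (hcomp F n).

(** Each factor contributes 1 or its linear term. The scalar [c] is -1 for the e-h convolution and 1
    for Newton's identities. *)
Lemma coef_prod_1DcX (c : MP) (k : nat) :
  (\prod_(i < n) (1 + (c * 'X_i)%:P * 'X))`_k = c ^+ k * e k.
Proof.
under eq_bigr do rewrite addrC.
rewrite bigA_distr coef_sum /mesym mulr_sumr [RHS]big_mkcond /=.
apply: eq_bigr => J _.
rewrite -big_mkcond /= big_split /= prodr_const -rmorph_prod /= coefCM coefXn.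
rewrite big_split /= prodr_const eq_sym.
by case: eqP => [->|_]; rewrite ?mulr1 ?mulr0.
Qed.

Lemma mcoeff_hcomp (k : nat) (m : 'X_{1..n}) : (h k)@_m = (mdeg m == k)%:R.
Proof.
rewrite /hcomp raddf_sum /=; under eq_bigr do rewrite mcoeffX.
case: eqP => [dm|ne]; last first.
  by rewrite big1 // => b /eqP db; case: eqP => // E; case: ne; rewrite -E.
have ltm : (mdeg m < k.+1)%N by rewrite dm.
rewrite (bigD1 (BMultinom ltm)) /= ?dm //= eqxx big1 ?addr0 // => b /andP[_ nb].
by case: eqP => // E; case/eqP: nb; apply/val_inj.
Qed.

Lemma hcomp_sym k : h k \is symmetric.
Proof.
by apply/issymP => s; apply/mpolyP => m; rewrite mcoeff_sym !mcoeff_hcomp mdeg_mperm.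
Qed.

Lemma hcomp_homog k : h k \is k.-homog.
Proof.
apply/dhomogP => m; rewrite mcoeff_msupp mcoeff_hcomp.
by case: (mdeg m =P k) => [//|_]; rewrite eqxx.
Qed.

Lemma hcomp0 : h 0 = 1.
Proof. by apply/mpolyP => m; rewrite mcoeff_hcomp mcoeff1 mdeg_eq0. Qed.

Lemma psum_sym k : psum F n k \is symmetric.
Proof.
apply/issymP => s; rewrite /psum raddf_sum /=.
rewrite [RHS](reindex_inj (@perm_inj _ s)) /=.
apply: eq_bigr => i _; rewrite rmorphXn /=; congr (_ ^+ _).
by rewrite /msym mmapX mmap1U.
Qed.

Lemma psum_homog k : psum F n k \is k.-homog.
Proof.
apply: rpred_sum => i _; rewrite mpolyXn dhomogX /=.
by rewrite mdegMn mdeg1 mul1n.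
Qed.

(** Cutting each series 1/(1 - x_i X) after degree [k] leaves the coefficient of X^k unchanged. *)
Lemma coef_prod_geometric (k : nat) :
  (\prod_(i < n) \sum_(a < k.+1) ('X_i ^+ a)%:P * 'X^a)`_k = h k.
Proof.
rewrite bigA_distr_bigA coef_sum; apply/mpolyP => m.
rewrite raddf_sum /= mcoeff_hcomp.
have E (f : {ffun 'I_n -> 'I_k.+1}) :
    (\prod_i (('X_i ^+ f i)%:P * 'X^(f i)) : {poly MP})`_k =
      if (\sum_i f i == k)%N then 'X_[[multinom (f i : nat) | i < n]] else 0.
  rewrite big_split /= prodrXr -rmorph_prod /= coefCM coefXn eq_sym.
  case: eqP => _; rewrite ?mulr1 ?mulr0 //.
  rewrite [RHS]mpolyXE_id; by apply: eq_bigr => i _; rewrite mnmE.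
under eq_bigr do rewrite E.
have D (f : {ffun 'I_n -> 'I_k.+1}) :
    mdeg [multinom (f i : nat) | i < n] = (\sum_i f i)%N.
  by rewrite mdegE; apply: eq_bigr => i _; rewrite mnmE.
case: eqP => [dm|ne]; last first.
  rewrite big1 // => f _; case: eqP => [df|]; rewrite ?mcoeff0 //.
  by rewrite mcoeffX; case: eqP => // E'; case: ne; rewrite -E' D.
pose f0 : {ffun 'I_n -> 'I_k.+1} := [ffun i => inord (m i)].
have vf0 i : f0 i = m i :> nat.
  rewrite ffunE inordK // ltnS -dm mdegE (bigD1 i) //= leq_addr //.
have mf0 : [multinom (f0 i : nat) | i < n] = m by apply/mnmP => i; rewrite mnmE.
rewrite (bigD1 f0) //= -D mf0 dm eqxx mcoeffX eqxx big1 ?addr0 // => f ne.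
case: ifP => _; rewrite ?mcoeff0 // mcoeffX; case: eqP => // E'.
case/eqP: ne; apply/ffunP => i; apply/val_inj; rewrite /= vf0 -E' mnmE //.
Qed.

(** Coefficient of X^k in E(-X) H(X) = 1; with H truncated, the identity holds modulo X^(k+1). *)
Lemma mesym_hcomp_conv (k : nat) : (0 < k)%N ->
  \sum_(j < k.+1) (-1) ^+ j * e j * h (k - j) = 0.
Proof.
move=> k_gt0.
pose A (N : nat) : {poly MP} := \prod_(i < n) \sum_(a < N.+1) ('X_i ^+ a)%:P * 'X^a.
pose B : {poly MP} := \prod_(i < n) (1 + (-1 * 'X_i)%:P * 'X).
(* All factors are cut at [k]; cutting them at [j] instead gives the same product modulo X^(j+1). *)
have coefA j : (j <= k)%N -> (A k)`_j = h j.
  move=> le_jk; rewrite -coef_prod_geometric.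
  suff [q ->] : exists q, A k = A j + 'X^(j.+1) * q.
    by rewrite coefD coefXnM ltnSn addr0.
  rewrite /A; elim/big_rec2: _ => [|i p1 p2 _ [q ->]].
    by exists 0; rewrite mulr0 addr0.
  have [r ->] : exists r, \sum_(a < k.+1) ('X_i ^+ a)%:P * 'X^a =
     \sum_(a < j.+1) ('X_i ^+ a)%:P * 'X^a + 'X^(j.+1) * r :> {poly MP}.
    rewrite -(subnKC le_jk) -addSn big_split_ord /=.
    exists (\sum_(i0 < k - j) ('X_i ^+ (j.+1 + i0))%:P * 'X^i0).
    by rewrite mulr_sumr; congr (_ + _); apply: eq_bigr => a _; rewrite ['X^_]exprD mulrCA.
  set S := \sum_(_ < _) _.
  exists (S * q + r * (p1 + 'X^(j.+1) * q)).
  by move: 'X^(j.+1) => Y; ring.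
have [q E] : exists q, B * A k = 1 + 'X^(k.+1) * q.
  rewrite -big_split /=; elim/big_rec: _ => [|i p _ [q ->]].
    by exists 0; rewrite mulr0 addr0.
  have -> : 1 + (-1 * 'X_i)%:P * 'X = 1 - ('X_i)%:P * 'X :> {poly MP}.
    by rewrite mulN1r polyCN mulNr.
  rewrite [(1 - _) * _]mulrC geometric_sum_factor.
  exists (q - ('X_i ^+ k.+1)%:P * (1 + 'X^(k.+1) * q)).
  move: (_%:P) => c.
  by move: 'X^(k.+1) => Y; ring.
have := congr1 (fun p : {poly MP} => p`_k) E.
rewrite coefD coefXnM ltnSn addr0 coef1 gtn_eqF // coefM => E2; rewrite -[RHS]E2.
apply: eq_bigr => j _; rewrite coefA ?leq_subr // /B coef_prod_1DcX //.
Qed.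

(** Logarithmic derivative of prod (1 + x_i X), with x_i / (1 + x_i X) truncated to [G i]; hence a
    relation modulo X^(k+1). *)
Lemma newton (k : nat) :
  e k.+1 *+ k.+1 = \sum_(j < k.+1) (-1) ^+ j * psum F n j.+1 * e (k - j).
Proof.
pose G i : {poly MP} := ('X_i)%:P * \sum_(a < k.+1) ((- 'X_i) ^+ a)%:P * 'X^a.
pose u i : {poly MP} := 1 + (1 * 'X_i)%:P * 'X.
have [q E] : exists q, (\prod_(i < n) u i)^`() + 'X^(k.+1) * q =
     (\sum_(i < n) G i) * (\prod_(i < n) u i).
  elim/big_rec2: _ => [|i p s _ [q E]].
    by exists 0; rewrite mulr0 addr0 mul0r derivC.
  have Ei : G i * u i = ('X_i)%:P - 'X^(k.+1) * ('X_i * (- 'X_i) ^+ k.+1)%:P.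
    have uE : u i = 1 - (- 'X_i)%:P * 'X by rewrite /u mul1r polyCN mulNr opprK.
    rewrite uE /G -mulrA geometric_sum_factor polyCM.
    move: ('X_i)%:P ((- 'X_i) ^+ k.+1)%:P => x c; move: 'X^(k.+1) => Y; ring.
  have du : (u i)^`() = ('X_i)%:P.
    by rewrite /u derivD derivC add0r derivM derivC mul0r add0r derivX mulr1 mul1r.
  exists (u i * q - ('X_i * (- 'X_i) ^+ k.+1)%:P * s).
  rewrite derivM du [RHS]mulrDl mulrA Ei [p * _]mulrCA -E.
  move: (_ * _ ^+ _)%:P ('X_i)%:P (u i) (s^`()) => c x ui s'.
  by move: 'X^(k.+1) => Y; ring.
have := congr1 (fun p : {poly MP} => p`_k) E.
rewrite coefD coefXnM ltnSn addr0 coef_deriv coef_prod_1DcX expr1n mul1r => ->.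
rewrite coefM; apply: eq_bigr => j _; rewrite coef_prod_1DcX expr1n mul1r.
congr (_ * _); rewrite coef_sum /psum mulr_sumr; apply: eq_bigr => i _.
rewrite /G coefCM coef_sum (bigD1 j) //= coefCM coefXn eqxx mulr1.
rewrite big1 ?addr0 => [|a ne]; first by rewrite [(- 'X_i) ^+ _]exprNn mulrCA -exprS.
by rewrite coefCM coefXn eq_sym; move: ne; rewrite -val_eqE /= => /negPf->; rewrite mulr0.
Qed.

End SymmetricIdentities.

(** * The Jacobi-Trudi expansion through linear recurrences *)

Section JacobiTrudi.
Variables (F : fieldType) (m : nat).
Local Notation MP := {mpoly F[m]}.
Local Notation e := (mesym m F).
Local Notation h := (hcomp F m).

(** The case a < j is set to 0 by hand: truncated subtraction on [nat] would give h_0 = 1. *)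
Definition hshift (a j : nat) : MP := if (j <= a)%N then h (a - j) else 0.

Definition e_recurrent (u : nat -> MP) :=
  forall a, (m <= a)%N -> \sum_(k < m.+1) (-1) ^+ k * e k * u (a - k)%N = 0.

(** Since e_0 = 1, each value from index m on is determined by the m previous ones. *)
Lemma e_recurrent_eq0 (u : nat -> MP) : e_recurrent u ->
  (forall a, (a < m)%N -> u a = 0) -> forall a, u a = 0.
Proof.
move=> rec_u u0; elim/ltn_ind => a IH.
case: (ltnP a m) => [/u0 //|le_ma].
have := rec_u a le_ma; rewrite big_ord_recl expr0 mesym0E !mul1r subn0.
rewrite big1 ?addr0 // => k _; rewrite IH ?mulr0 //.
by rewrite lift0; have := ltn_ord k; lia.
Qed.

Lemma sum_ord_widen (V : nmodType) (G : nat -> V) (N M : nat) : (N <= M)%N ->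
  (forall k, (N <= k < M)%N -> G k = 0) -> \sum_(k < N) G k = \sum_(k < M) G k.
Proof.
move=> le_NM G0; rewrite -!(big_mkord xpredT) (big_cat_nat (leq0n N) le_NM) /=.
by rewrite [X in _ = _ + X]big_nat_cond [X in _ = _ + X]big1 ?addr0 // => k;
  rewrite andbT => /G0.
Qed.

Lemma hshift_recurrent (j : 'I_m) : e_recurrent (hshift^~ j).
Proof.
move=> a le_ma; have lt_jm := ltn_ord j.
(* The sum up to m and the convolution sum up to a - j both extend to the sum up to a: e_k vanishes
   for k > m, [hshift] for k > a - j. *)
pose G k : MP := (-1) ^+ k * e k * hshift (a - k) j.
rewrite (sum_ord_widen (G := G) (M := a.+1)) //; last first.
  by move=> k /andP[lt_mk _]; rewrite /G mesym_geqnE // mulr0 mul0r.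
rewrite -(sum_ord_widen (G := G) (N := (a - j).+1)); first last.
- move=> k /andP[lt_ak le_ka]; rewrite /G /hshift ifF ?mulr0 //.
  by apply/negbTE; lia.
- by lia.
rewrite -[RHS](@mesym_hcomp_conv F m (a - j)); last by lia.
apply: eq_bigr => k _; have := ltn_ord k; rewrite /G /hshift ltnS => le_k.
by rewrite ifT; [congr (_ * h _)|]; lia.
Qed.

(** x_l is a root of prod_i (T - x_i), whose coefficients are the signed e_k. *)
Lemma X_recurrent (l : 'I_m) : e_recurrent (fun a => 'X_l ^+ a).
Proof.
move=> a le_ma.
transitivity ('X_l ^+ (a - m) * \sum_(k < m.+1) (-1) ^+ k * e k * 'X_l ^+ (m - k)).
  rewrite mulr_sumr; apply: eq_bigr => k _; rewrite mulrCA -exprD.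
  by congr (_ * 'X_l ^+ _); have := ltn_ord k; lia.
suff -> : \sum_(k < m.+1) (-1) ^+ k * e k * 'X_l ^+ (m - k) =
    \prod_(i < m) (- 'X_i + 'X_l) :> MP.
  by rewrite (bigD1 l) //= addNr mul0r mulr0.
rewrite bigA_distr (partition_big (fun J : {set 'I_m} => inord #|J| : 'I_m.+1) xpredT) //=.
apply: eq_bigr => k _; rewrite /mesym mulr_sumr mulr_suml.
apply: eq_big => [J|J /eqP cJ].
  rewrite -val_eqE /= inordK //.
  by rewrite ltnS -[X in (_ <= X)%N]card_ord max_card.
rewrite [RHS](bigID (mem J)) /=.
rewrite [X in _ = X * _](eq_bigr (fun i => -1 * 'X_i)) => [|i iJ]; last first.
  by rewrite iJ mulN1r.
rewrite [X in _ = _ * X](eq_bigr (fun=> 'X_l)) => [|i /negPf iJ]; last by rewrite iJ.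
rewrite big_split /= !prodr_const cJ.
suff -> : #|[pred i | i \notin J]| = (m - k)%N by [].
by have := cardC J; rewrite card_ord cJ => /esym E;
  rewrite [RHS](congr1 (subn^~ k) E) addKn.
Qed.

Definition alternant (f : 'I_m -> nat) : MP :=
  \det (\matrix_(i < m, l < m) 'X_l ^+ f i).

Definition delta (i : 'I_m) : nat := i.

Lemma alternant_delta_neq0 : alternant delta != 0.
Proof.
have -> : alternant delta = \det (Vandermonde m (\row_(l < m) ('X_l : MP))).
  by congr (\det _); apply/matrixP => i l; rewrite !mxE.
rewrite det_Vandermonde; apply/prodf_neq0 => i _; apply/prodf_neq0 => j lt_ij.
rewrite !mxE subr_eq0; apply/eqP => /(congr1 (mcoeff U_(j))) /eqP.
have /negPf ne : U_(i)%MM != U_(j)%MM.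
  apply/eqP => /mnmP/(_ i); rewrite !mnmE eqxx => /esym/eqP.
  by rewrite eqb1 -val_eqE /= gtn_eqF.
by rewrite !mcoeffX eqxx ne oner_eq0.
Qed.

(* The rows [hshift a _] and [a |-> 'X_l ^+ a] obey the same linear recurrence
   of order m, so the matrix relating their first m values relates all of them. *)
Lemma alternantE (f : 'I_m -> nat) :
  alternant f = \det (\matrix_(i < m, j < m) hshift (f i) j) * alternant delta.
Proof.
pose H0 : 'M[MP]_m := \matrix_(a < m, j < m) hshift a j.
have detH0 : \det H0 = 1.
  rewrite det_trig; last first.
    by apply/is_trig_mxP => i j lt_ij; rewrite mxE /hshift leqNgt lt_ij.
  by rewrite big1 // => i _; rewrite mxE /hshift leqnn subnn hcomp0.
have H0_unit : H0 \in unitmx by rewrite unitmxE detH0 unitr1.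
pose V0 : 'M[MP]_m := \matrix_(i < m, l < m) 'X_l ^+ i.
pose M := invmx H0 *m V0.
have detM : \det M = alternant delta.
  rewrite -[LHS]mul1r -detH0 -det_mulmx mulmxA mulmxV // mul1mx.
  by congr (\det _); apply/matrixP => i l; rewrite !mxE.
have HM a (l : 'I_m) : \sum_(j < m) hshift a j * M j l = 'X_l ^+ a.
  apply/eqP; rewrite -subr_eq0; apply/eqP; move: a.
  apply: e_recurrent_eq0 => [a le_ma|a lt_am]; last first.
    have /matrixP/(_ (Ordinal lt_am) l) : H0 *m M = V0.
      by rewrite mulmxA mulmxV // mul1mx.
    rewrite !mxE => <-; apply/eqP; rewrite subr_eq0; apply/eqP.
    by apply: eq_bigr => j _; rewrite !mxE.
  under eq_bigr do rewrite mulrBr mulr_sumr.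
  rewrite sumrB X_recurrent // subr0 exchange_big /= big1 // => j _.
  under eq_bigr do rewrite mulrA.
  by rewrite -mulr_suml hshift_recurrent // mul0r.
rewrite -detM -det_mulmx; congr (\det _); apply/matrixP => i l.
by rewrite !mxE -HM; apply: eq_bigr => j _; rewrite !mxE.
Qed.

Lemma alternant_msym (f : 'I_m -> nat) :
  alternant f = \sum_(s : 'S_m) (-1) ^+ s * msym s 'X_[[multinom f i | i < m]].
Proof.
apply: eq_bigr => s _; congr (_ * _).
rewrite /msym mmapX /mmap1; apply: eq_bigr => i _.
by rewrite !mxE mnmE.
Qed.

Lemma symmetric_mul_alternant (p : MP) : p \is symmetric ->
  p * alternant delta =
  \sum_(b <- msupp p) p@_b *: alternant (fun i => (b i + delta i)%N).
Proof.
move=> /issymP symp; rewrite alternant_msym mulr_sumr.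
under [RHS]eq_bigr do rewrite alternant_msym scaler_sumr.
rewrite exchange_big /=; apply: eq_bigr => s _.
rewrite mulrCA -{1}(symp s) -msymM {1}[p]mpolyE mulr_suml raddf_sum mulr_sumr.
apply: eq_bigr => b _ /=; rewrite -scalerAl -mpolyXD msymZ -scalerAr.
by congr (_ *: (_ * msym s 'X_[_])); apply/mnmP => i; rewrite !mnmE.
Qed.

(** The nonzero Vandermonde determinant cancels. As [b] runs over all monomials of p, not only
    partitions, each determinant is zero or a Schur polynomial up to sign. *)
Lemma jacobi_trudi_expansion (p : MP) : p \is symmetric ->
  p = \sum_(b <- msupp p)
        p@_b *: \det (\matrix_(i < m, j < m) hshift (b i + i) j).
Proof.
move=> symp; apply: (mulIf alternant_delta_neq0).
rewrite symmetric_mul_alternant // mulr_suml; apply: eq_bigr => b _.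
by rewrite alternantE -scalerAl.
Qed.

End JacobiTrudi.

(** * Spans of m-fold products *)

Section ProdSpan.
Variables (F : fieldType) (k m : nat).
Local Notation MP := {mpoly F[k]}.

(** The index is a formal weight, not a degree, so that it survives replacing h_i by a formal
    polynomial and then by h_(2i). Shorter products are included through [g 0], which is 1 in all
    uses. *)
Inductive prod_span (g : nat -> MP) : nat -> MP -> Prop :=
| prod_span0 u : prod_span g u 0
| prod_spanD u c x y : prod_span g u x -> prod_span g u y -> prod_span g u (c *: x + y)
| prod_spanM (f : 'I_m -> nat) : prod_span g (\sum_i f i) (\prod_i g (f i)).

Lemma prod_span_sum (I : eqType) (r : seq I) (g : nat -> MP) u (c : I -> F) (x : I -> MP) :
  (forall i, i \in r -> prod_span g u (x i)) ->
  prod_span g u (\sum_(i <- r) c i *: x i).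
Proof.
elim: r => [|i r IH] xP; first by rewrite big_nil; constructor.
rewrite big_cons; constructor; first by apply: xP; rewrite mem_head.
by apply: IH => j jr; apply: xP; rewrite inE jr orbT.
Qed.

End ProdSpan.

Section HomogeneousProdSpan.
Variables (F : fieldType) (m : nat).
Local Notation MP := {mpoly F[m]}.

(** In a Leibniz term the shifts i - s(i) sum to 0, so the m indices of h sum to the degree of [b];
    a term with a negative index vanishes. *)
Lemma prod_span_det_hshift (b : 'X_{1..m}) :
  prod_span m (hcomp F m) (mdeg b)
    (\det (\matrix_(i < m, j < m) hshift F m (b i + i) j)).
Proof.
rewrite /determinant.
have -> : \sum_(s : 'S_m) (-1) ^+ s * \prod_i (\matrix_(i, j) hshift F m (b i + i) j) i (s i)
  = \sum_(s : 'S_m) ((-1) ^+ s : F) *: \prod_i hshift F m (b i + i) (s i).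
  apply: eq_bigr => s _; rewrite scaler_sign mulr_sign.
  by case: (odd_perm s); [congr (- _)|]; apply: eq_bigr => i _; rewrite mxE.
apply: prod_span_sum => s _.
case: (altP (@forallP _ (fun i : 'I_m => (s i <= b i + i)%N))) => [le_s|]; last first.
  rewrite negb_forall => /existsP[i /negPf nle].
  by rewrite (bigD1 i) //= /hshift nle mul0r; constructor.
pose f i := (b i + i - s i)%N.
have -> : mdeg b = (\sum_i f i)%N.
  have : (\sum_(i < m) (f i + s i) = \sum_(i < m) (b i + i))%N.
    by apply: eq_bigr => i _; rewrite /f subnK.
  rewrite !big_split /= -mdegE [in RHS](reindex_inj (@perm_inj _ s)) /=.
  by move/addIn.
have -> : \prod_i hshift F m (b i + i) (s i) = \prod_i hcomp F m (f i).
  by apply: eq_bigr => i _; rewrite /hshift le_s.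
exact: prod_spanM.
Qed.

Lemma prod_span_symmetric (p : MP) u :
  p \is symmetric -> p \is u.-homog -> prod_span m (hcomp F m) u p.
Proof.
move=> symp /dhomogP homp; rewrite (jacobi_trudi_expansion symp).
by apply: prod_span_sum => b /homp <-; exact: prod_span_det_hshift.
Qed.

End HomogeneousProdSpan.

Lemma big_ord_parity (R : Type) (idx : R) (op : Monoid.com_law idx) (n : nat) (G : nat -> R) :
  \big[op/idx]_(i < n) G i =
  op (\big[op/idx]_(j < n.+1./2) G (2 * j)%N) (\big[op/idx]_(k < n./2) G (2 * k).+1).
Proof.
elim: n => [|n IH]; first by rewrite !big_ord0 Monoid.mul1m.
rewrite big_ord_recr IH; have -> : (n.+2./2 = n./2.+1)%N by [].
case oddn: (odd n).
  have -> : (n.+1./2 = n./2.+1)%N by lia.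
  rewrite [in RHS](@big_ord_recr _ _ op n./2 (fun k => G (2 * k).+1)) /= Monoid.mulmA.
  by congr (op _ (G _)); lia.
have -> : (n.+1./2 = n./2)%N by lia.
rewrite [in RHS](@big_ord_recr _ _ op n./2 (fun j => G (2 * j)%N)) /= Monoid.mulmAC.
by congr (op (op _ (G _)) _); lia.
Qed.

(** * The graded ideal generated by the odd power sums *)

Section OddIdeal.
Variables (F : fieldType) (n : nat).
Hypothesis charF : [pchar F] =i pred0.
Local Notation MP := {mpoly F[n]}.
Local Notation e := (mesym n F).
Local Notation h := (hcomp F n).
Local Notation p_ := (psum F n).

(** Degree-[u] part of an ideal of the ring of symmetric polynomials. Generators have positive
    degree, so the cofactors [s] have smaller degree, which drives the later induction. *)
Inductive odd_ideal : nat -> MP -> Prop :=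
| odd_ideal0 u : odd_ideal u 0
| odd_idealD u x y : odd_ideal u x -> odd_ideal u y -> odd_ideal u (x + y)
| odd_ideal_psum (j : 'I_(nodd n)) u s : s \is symmetric -> s \is u.-homog ->
    odd_ideal ((2 * j).+1 + u) (p_ (2 * j).+1 * s).

Lemma odd_ideal_sym u x : odd_ideal u x -> x \is symmetric.
Proof.
elim=> [{}u|{}u y z _ ys _ zs|j {}u s ss _]; first exact: rpred0.
  exact: rpredD.
by rewrite rpredM ?psum_sym.
Qed.

Lemma odd_ideal_homog u x : odd_ideal u x -> x \is u.-homog.
Proof.
elim=> [{}u|{}u y z _ ys _ zs|j {}u s _ hs]; first exact: rpred0.
  exact: rpredD.
by rewrite dhomogM ?psum_homog.
Qed.

Lemma odd_idealM u v x s : odd_ideal u x -> s \is symmetric -> s \is v.-homog ->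
  odd_ideal (u + v) (s * x).
Proof.
move=> Jx ss hs; elim: Jx => [{}u|{}u y z _ Jy _ Jz|j {}u t st ht].
- by rewrite mulr0; constructor.
- by rewrite mulrDr; constructor.
rewrite mulrCA -addnA; constructor; first exact: rpredM.
by rewrite addnC dhomogM.
Qed.

Lemma odd_idealZ u c x : odd_ideal u x -> odd_ideal u (c *: x).
Proof.
move=> Jx; rewrite -mul_mpolyC -[u]addn0; apply: odd_idealM => //.
  by rewrite -alg_mpolyC rpredZ ?rpred1.
by rewrite -alg_mpolyC rpredZ ?dhomog1.
Qed.

Lemma odd_ideal_sum (I : Type) (r : seq I) (P : pred I) (G : I -> MP) u :
  (forall i, P i -> odd_ideal u (G i)) -> odd_ideal u (\sum_(i <- r | P i) G i).
Proof. by move=> JG; elim/big_ind: _ => // *; constructor. Qed.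

(** In Newton's identity at an odd index, each term pairs p and e of opposite parities: either p is
    a generator or induction applies to e. Characteristic 0 permits division by the index. *)
Lemma mesym_odd_ideal k : odd k -> odd_ideal k (e k).
Proof.
elim/ltn_ind: k => -[//|k] IH oddk.
(* Beyond n, e vanishes; otherwise every odd p that occurs has index at most n, hence is a
   generator. *)
case: (ltnP n k.+1) => [gt_kn|le_kn]; first by rewrite mesym_geqnE //; constructor.
have k_neq0 : k.+1%:R != 0 :> F by rewrite (pcharf0P F).1.
have -> : e k.+1 = k.+1%:R^-1 *: (e k.+1 *+ k.+1).
  by rewrite -scaler_nat scalerA mulVf ?scale1r.
apply: odd_idealZ; rewrite newton; apply: odd_ideal_sum => -[j lt_jk] _ /=.
have le_jk : (j <= k)%N by rewrite -ltnS.
rewrite -mulrA.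
have -> : (-1) ^+ j * (p_ j.+1 * e (k - j)) = (-1) ^+ j *: (p_ j.+1 * e (k - j)) :> MP.
  by rewrite -mul_mpolyC rmorphXn rmorphN1.
apply: odd_idealZ; case oddj: (odd j).
  have -> : k.+1 = (k - j + j.+1)%N by lia.
  by apply: odd_idealM; [apply: IH; lia|exact: psum_sym|exact: psum_homog].
have lt_j2 : (j./2 < nodd n)%N by rewrite /nodd; lia.
have Ej : j = (2 * Ordinal lt_j2)%N :> nat by rewrite /=; lia.
have -> : k.+1 = (j.+1 + (k - j))%N by lia.
by rewrite (congr1 S Ej); constructor; [exact: mesym_sym|exact: dhomog_mesym].
Qed.

Lemma odd_ideal_prodB (I : finType) (w : I -> nat) (x y : I -> MP) :
  (forall i, y i \is symmetric) -> (forall i, y i \is (w i).-homog) ->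
  (forall i, odd_ideal (w i) (x i - y i)) ->
  odd_ideal (\sum_i w i) (\prod_i x i - \prod_i y i).
Proof.
move=> sy hy Jxy.
suff [] : [/\ odd_ideal (\sum_i w i) (\prod_i x i - \prod_i y i),
  \prod_i y i \is symmetric & \prod_i y i \is (\sum_i w i)%N.-homog] by [].
elim/big_rec3: _ => [|i u q v _ [Jqv sv hv]].
  by split; rewrite ?subrr ?rpred1 ?dhomog1 //; constructor.
split; [|exact: rpredM|exact: dhomogM].
have xE : x i = y i + (x i - y i) by rewrite addrC subrK.
have -> : x i * q - y i * u = x i * (q - u) + u * (x i - y i) by ring.
constructor; last by apply: odd_idealM.
rewrite addnC; apply: odd_idealM => //.
  by rewrite xE rpredD // (odd_ideal_sym (Jxy i)).
by rewrite xE; apply: rpredD; [exact: hy|exact: odd_ideal_homog (Jxy i)].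
Qed.

End OddIdeal.

(** * Reduction to m variables modulo the odd power sums *)

Section EvenPart.
Variables (F : fieldType) (n : nat).
Hypothesis charF : [pchar F] =i pred0.
Local Notation m := n./2.
Local Notation T := {mpoly F[m]}.
Local Notation MP := {mpoly F[n]}.
Local Notation Sm := [tuple mesym m F i.+1 | i < m].

(* The elementary and complete symmetric polynomials in m variables, written in
   terms of the formal variables ['X_i], standing for e_(i+1). *)
Definition fmesym (k : nat) : T := sval (sym_fundamental (mesym_sym m F k)).
Definition fhcomp (k : nat) : T := sval (sym_fundamental (hcomp_sym F m k)).

Lemma fmesymK k : fmesym k \mPo Sm = mesym m F k.
Proof. by rewrite /fmesym; case: sym_fundamental => t [] /=. Qed.

Lemma fhcompK k : fhcomp k \mPo Sm = hcomp F m k.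
Proof. by rewrite /fhcomp; case: sym_fundamental => t [] /=. Qed.

Lemma fmesym0 : fmesym 0 = 1.
Proof. by apply: msym_fundamental_un; rewrite fmesymK mesym0E rmorph1. Qed.

Lemma fhcomp0 : fhcomp 0 = 1.
Proof. by apply: msym_fundamental_un; rewrite fhcompK hcomp0 rmorph1. Qed.

Lemma fmesymS (k : 'I_m) : fmesym k.+1 = 'X_k.
Proof.
by apply: msym_fundamental_un; rewrite fmesymK comp_mpolyXU -tnth_nth tnth_mktuple.
Qed.

Lemma fmesym_gt k : (m < k)%N -> fmesym k = 0.
Proof.
by move=> lt_mk; apply: msym_fundamental_un; rewrite fmesymK mesym_geqnE ?raddf0.
Qed.

(** Substituting e_1, ..., e_m is injective, so the identity in m variables lifts to the formal
    ones. *)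
Lemma fmesym_fhcomp_conv (k : nat) : (0 < k)%N ->
  \sum_(j < k.+1) (-1) ^+ j * fmesym j * fhcomp (k - j) = 0.
Proof.
move=> k_gt0; apply: msym_fundamental_un; rewrite raddf0 raddf_sum /=.
rewrite -[RHS](mesym_hcomp_conv F m k_gt0); apply: eq_bigr => j _.
by rewrite !rmorphM rmorphXn rmorphN1 /= fmesymK fhcompK.
Qed.

(* Modulo the odd power sums the variables x_i behave like y_1, -y_1, y_2, -y_2, ...:
   e_(2k) becomes (-1)^k e_k(y^2), and h_(2k) becomes h_k(y^2). *)
Definition even_mesyms : m.-tuple MP :=
  [tuple (-1) ^+ i.+1 * mesym n F (2 * i.+1) | i < m].

Lemma fmesym_even k : fmesym k \mPo even_mesyms = (-1) ^+ k * mesym n F (2 * k).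
Proof.
case: k => [|k]; first by rewrite fmesym0 rmorph1 muln0 mesym0E expr0 mul1r.
case: (ltnP k m) => [lt_km|le_mk].
  by rewrite (fmesymS (Ordinal lt_km)) comp_mpolyXU -tnth_nth tnth_mktuple.
(* Both sides vanish, as 2(k+1) > n once k >= n./2. *)
by rewrite fmesym_gt // raddf0 mesym_geqnE ?mulr0 //; lia.
Qed.

(** Strong induction comparing two convolutions: the formal one at [k] after substitution, and the
    one in n variables at 2k. The signs in [even_mesyms] make the even terms agree; the odd terms
    lie in the ideal. *)
Lemma fhcomp_even k :
  odd_ideal (2 * k) (fhcomp k \mPo even_mesyms - hcomp F n (2 * k)).
Proof.
elim/ltn_ind: k => k IH.
case: (posnP k) => [->|k_gt0].
  by rewrite fhcomp0 rmorph1 muln0 hcomp0 subrr; constructor.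
have := congr1 (comp_mpoly even_mesyms) (fmesym_fhcomp_conv k_gt0).
rewrite raddf0 raddf_sum /= big_ord_recl expr0 mul1r fmesym0 mul1r subn0 => /eqP.
rewrite addr_eq0 => /eqP ->.
have k2_gt0 : (0 < 2 * k)%N by lia.
have := mesym_hcomp_conv F n k2_gt0.
rewrite (big_ord_parity _ _ (fun j => (-1) ^+ j * mesym n F j * hcomp F n (2 * k - j))).
have -> : ((2 * k).+2./2 = k.+1)%N by lia.
have -> : ((2 * k).+1./2 = k)%N by lia.
rewrite /= big_ord_recl muln0 expr0 mul1r mesym0E mul1r subn0 -addrA => /eqP.
rewrite addr_eq0 => /eqP ->; rewrite opprK addrA [- _ + _]addrC.
constructor.
  rewrite -sumrB; apply: odd_ideal_sum => i _.
  rewrite lift0 !rmorphM rmorphXn rmorphN1 /= fmesym_even.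
  rewrite mulrA -exprMn mulrNN mulr1 expr1n mul1r.
  rewrite exprM sqrrN !expr1n mul1r.
  have -> : (2 * k - 2 * i.+1 = 2 * (k - i.+1))%N by lia.
  rewrite -mulrBr.
  have [E lt_k] : (2 * k = 2 * (k - i.+1) + 2 * i.+1)%N /\ (k - i.+1 < k)%N.
    by have := ltn_ord i; lia.
  rewrite [X in odd_ideal X _]E; apply: odd_idealM.
  - by rewrite -opprB -scaleN1r; apply: odd_idealZ; exact: IH.
  - exact: mesym_sym.
  - exact: dhomog_mesym.
apply: odd_ideal_sum => i _; have := ltn_ord i => lt_ik.
have E : (2 * k = (2 * i).+1 + (2 * k - (2 * i).+1))%N by lia.
rewrite [X in odd_ideal X _]E mulrC.
apply: odd_idealM; [|exact: hcomp_sym|exact: hcomp_homog].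
have -> : (-1) ^+ (2 * i).+1 * mesym n F (2 * i).+1 = -1 *: mesym n F (2 * i).+1.
  by rewrite exprS exprM sqrrN !expr1n mulr1 mulN1r scaleN1r.
by apply: odd_idealZ; apply: mesym_odd_ideal => //; lia.
Qed.

Lemma prod_span_fhcomp u x : prod_span m (hcomp F m) u x ->
  exists2 q, prod_span m fhcomp u q & q \mPo Sm = x.
Proof.
elim=> [{}u|{}u c y z _ [q sq <-] _ [r sr <-]|f].
- by exists 0; [constructor|rewrite raddf0].
- by exists (c *: q + r); [constructor|rewrite linearP].
exists (\prod_i fhcomp (f i)); first exact: prod_spanM.
by rewrite rmorph_prod /=; apply: eq_bigr => i _; rewrite fhcompK.
Qed.

Lemma prod_span_even u q : prod_span m fhcomp u q ->
  exists2 y, prod_span m (fun i => hcomp F n (2 * i)) u y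
    & odd_ideal (2 * u) (q \mPo even_mesyms - y).
Proof.
elim=> [{}u|{}u c x z _ [y sy Jy] _ [t st Jt]|f].
- by exists 0; [constructor|rewrite raddf0 subrr; constructor].
- exists (c *: y + t); first by constructor.
  rewrite linearP /= opprD addrACA -scalerBr; constructor => //.
  exact: odd_idealZ.
exists (\prod_i hcomp F n (2 * f i)); first exact: prod_spanM.
rewrite rmorph_prod /= big_distrr /=; apply: odd_ideal_prodB => i.
- exact: hcomp_sym.
- exact: hcomp_homog.
exact: fhcomp_even.
Qed.

(** At e_1, ..., e_m the monomial is symmetric of degree [mnmwgt a], hence a combination of m-fold
    products of h_i. This lifts to the formal variables and is then evaluated at [even_mesyms]. *)
Lemma monomial_even_mesyms (a : 'X_{1..m}) :
  exists2 y, prod_span m (fun i => hcomp F n (2 * i)) (mnmwgt a) y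
    & odd_ideal (2 * mnmwgt a) ('X_[a] \mPo even_mesyms - y).
Proof.
have /prod_span_fhcomp[q sq /msym_fundamental_un Eq] :
    prod_span m (hcomp F m) (mnmwgt a) ('X_[a] \mPo Sm).
  apply: prod_span_symmetric; last exact: dhomog_XS.
  by apply: mcomp_sym => i; rewrite -tnth_nth tnth_mktuple mesym_sym.
by rewrite -Eq; apply: prod_span_even.
Qed.

End EvenPart.

(** * Spanning, by induction on the degree *)

Section OddSpan.
Variables (F : fieldType) (n : nat).
Hypothesis charF : [pchar F] =i pred0.
Local Notation m := n./2.
Local Notation MP := {mpoly F[n]}.
Local Notation Sn := [tuple mesym n F i.+1 | i < n].

Definition odd_weight (g : 'X_{1..nodd n}) : nat := (\sum_j g j * (2 * j).+1)%N.

(** Coefficients are broken into monomials in the odd power sums, so that freeness over these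
    becomes linear independence over [F]. *)
Definition odd_term (g : 'X_{1..nodd n}) (I : seq nat) : MP :=
  ('X_[g] \mPo odd_psums F n) * hbasis F n I.

Inductive odd_span : nat -> MP -> Prop :=
| odd_span0 u : odd_span u 0
| odd_spanD u c x y : odd_span u x -> odd_span u y -> odd_span u (c *: x + y)
| odd_span_term g I : basis_index n I ->
    odd_span (odd_weight g + 2 * sumn I) (odd_term g I).

Lemma odd_spanZ u c x : odd_span u x -> odd_span u (c *: x).
Proof. by move=> Lx; rewrite -[_ *: _]addr0; constructor => //; constructor. Qed.

Lemma odd_span_sum (I : eqType) (r : seq I) (G : I -> MP) u :
  (forall i, i \in r -> odd_span u (G i)) -> odd_span u (\sum_(i <- r) G i).
Proof.
elim: r => [|i r IH] GP; first by rewrite big_nil; constructor.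
rewrite big_cons -[G i]scale1r; constructor; first by apply: GP; rewrite mem_head.
by apply: IH => j jr; apply: GP; rewrite inE jr orbT.
Qed.

Lemma odd_span_psum (j : 'I_(nodd n)) u x :
  odd_span u x -> odd_span ((2 * j).+1 + u) (psum F n (2 * j).+1 * x).
Proof.
elim=> [{}u|{}u c y z _ Ly _ Lz|g I bI].
- by rewrite mulr0; constructor.
- by rewrite mulrDr -scalerAr; constructor.
have -> : psum F n (2 * j).+1 * odd_term g I = odd_term (U_(j) + g)%MM I.
  rewrite /odd_term mpolyXD rmorphM /= mulrA comp_mpolyXU -tnth_nth tnth_mktuple.
  by [].
have -> : ((2 * j).+1 + (odd_weight g + 2 * sumn I) =
    odd_weight (U_(j) + g)%MM + 2 * sumn I)%N.
  rewrite addnA; congr (_ + _)%N; rewrite /odd_weight (bigD1 j) //=.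
  rewrite [RHS](bigD1 j) //= mnmDE mnm1E eqxx mulnDl mul1n -addnA; congr (_ + (_ + _))%N.
  by apply: eq_bigr => i /negPf ne; rewrite mnmDE mnm1E eq_sym ne.
exact: odd_span_term.
Qed.

Lemma odd_span_prod_span u x :
  prod_span m (fun i => hcomp F n (2 * i)) u x -> odd_span (2 * u) x.
Proof.
elim=> [{}u|{}u c y z _ Ly _ Lz|f]; [by constructor|by constructor|].
pose I := sort leq [seq f i | i <- enum 'I_m].
have pI : perm_eq I [seq f i | i <- enum 'I_m] by rewrite perm_sort.
have bI : basis_index n I.
  rewrite /basis_index sort_sorted ?andbT; last exact: leq_total.
  by rewrite size_sort size_map size_enum_ord.
have -> : \prod_i hcomp F n (2 * f i) = odd_term 0%MM I.
  rewrite /odd_term mpolyX0 rmorph1 mul1r /hbasis (perm_big _ pI) big_map.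
  by rewrite big_enum.
have -> : (2 * \sum_i f i = odd_weight 0%MM + 2 * sumn I)%N.
  rewrite /odd_weight [X in (X + _)%N]big1 ?add0n => [|j _]; last by rewrite mnm0E.
  by rewrite sumnE (perm_big _ pI) big_map big_enum.
exact: odd_span_term.
Qed.

(** The cofactors of the odd power sums have degree below [w], so the induction hypothesis covers
    them. *)
Lemma odd_span_odd_ideal w x :
  (forall u y, (u < w)%N -> y \is symmetric -> y \is u.-homog -> odd_span u y) ->
  odd_ideal w x -> odd_span w x.
Proof.
move=> IH Jx; elim: Jx IH => [u _|u y z _ Ly _ Lz IH|j u s ss hs IH].
- by constructor.
- by rewrite -[y]scale1r; constructor; [apply: Ly|apply: Lz].
by apply/odd_span_psum/IH => //; rewrite addSn ltnS leq_addl.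
Qed.

Lemma mesym_monomial_sym (a : 'X_{1..n}) : 'X_[a] \mPo Sn \is symmetric.
Proof. by apply: mcomp_sym => i; rewrite -tnth_nth tnth_mktuple mesym_sym. Qed.

(** Position [i] holds the exponent of e_(i+1), so only e_2, e_4, ... occur. Up to sign this is a
    monomial in [even_mesyms]: products of h_(2i) plus an element of the ideal, which [IH]
    handles. *)
Lemma even_monomial_span (a : 'X_{1..n}) :
  (forall u y, (u < mnmwgt a)%N -> y \is symmetric -> y \is u.-homog -> odd_span u y) ->
  (forall i : 'I_n, ~~ odd i -> a i = 0%N) ->
  odd_span (mnmwgt a) ('X_[a] \mPo Sn).
Proof.
move=> IH a_even; pose an k := nth 0%N a k.
have aE (i : 'I_n) : a i = an i by rewrite (mnm_nth 0%N).
have an0 j : an (2 * j)%N = 0%N.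
  case: (ltnP (2 * j) n) => [lt_jn|le_nj].
    by rewrite -(aE (Ordinal lt_jn)) a_even //= mul2n odd_double.
  by rewrite /an nth_default // size_tuple.
pose b : 'X_{1..m} := [multinom an (2 * k).+1 | k < m].
have wE : mnmwgt a = (2 * mnmwgt b)%N.
  rewrite /mnmwgt; under eq_bigr do rewrite aE.
  rewrite (big_ord_parity _ _ (fun i => an i * i.+1)%N) /= big1 ?add0n => [|j _].
    rewrite big_distrr /=; apply: eq_bigr => k _; rewrite mnmE; lia.
  by rewrite an0.
have [y sy Jy] := @monomial_even_mesyms F n charF b.
(* Compensates the signs (-1)^(k+1) that [even_mesyms] attaches to e_(2k+2). *)
pose c : F := (-1) ^+ (\sum_(k < m) k.+1 * b k).
have -> : 'X_[a] \mPo Sn = c *: ('X_[b] \mPo even_mesyms F n).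
  rewrite !comp_mpolyX.
  under eq_bigr do rewrite tnth_mktuple aE.
  rewrite (big_ord_parity _ _ (fun i => mesym n F i.+1 ^+ an i)) /= big1 ?mul1r => [|j _].
    rewrite /c -mul_mpolyC rmorphXn rmorphN1 -prodrXr -big_split /=.
    apply: eq_bigr => k _; rewrite tnth_mktuple exprMn -exprM mulrA -exprD addnn.
    by rewrite -signr_odd odd_double mul1r mnmE mulnS.
  by rewrite an0.
rewrite -(subrK y ('X_[b] \mPo _)) scalerDr -[X in X + _]scale1r.
rewrite wE in IH *; constructor; apply: odd_spanZ.
  exact: odd_span_odd_ideal.
exact: odd_span_prod_span.
Qed.

Lemma odd_monomial_ideal (a : 'X_{1..n}) (i : 'I_n) : ~~ odd i -> a i != 0%N ->
  odd_ideal (mnmwgt a) ('X_[a] \mPo Sn).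
Proof.
move=> oddi ai; have le_Ua : (U_(i) <= a)%MM by rewrite lep1mP.
rewrite -(submK le_Ua) mpolyXD rmorphM /= comp_mpolyXU -tnth_nth tnth_mktuple.
rewrite mfD /= addnC; apply: odd_idealM.
- by rewrite mnmwgt1; apply: mesym_odd_ideal.
- exact: mesym_monomial_sym.
exact: dhomog_XS.
Qed.

(** The fundamental theorem gives monomials of weight [w] in the e_i. Those without odd e_i fall
    under [even_monomial_span]; the others lie in the ideal. *)
Lemma symmetric_odd_span w p : p \is symmetric -> p \is w.-homog -> odd_span w p.
Proof.
elim/ltn_ind: w p => w IH p sp hp.
have [t [<- /dhomogP ht]] := sym_fundamental_homog sp hp.
rewrite comp_mpolyEX; apply: odd_span_sum => a a_t; rewrite -(ht a a_t).
apply: odd_spanZ; have IHa := IH; rewrite -(ht a a_t) in IHa.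
case: (altP (@forallP _ (fun i : 'I_n => ~~ odd i ==> (a i == 0%N)))) => [a_even|].
  apply: even_monomial_span => [u y lt_u|i /(implyP (a_even i))/eqP] //.
  exact: IHa.
rewrite negb_forall => /existsP; case=> i; rewrite negb_imply => /andP[oddi ai].
apply: odd_span_odd_ideal; last exact: odd_monomial_ideal oddi ai.
by move=> u y lt_u; apply: IHa.
Qed.

End OddSpan.

(** * Partial sums and differences; a linear algebra criterion for freeness *)

Lemma scanl_addn_sorted (x : nat) (s : seq nat) : path leq x (scanl addn x s).
Proof. by elim: s x => //= y s IH x; rewrite leq_addr IH. Qed.

Lemma scanl_addn_pairmap_subn (x : nat) (s : seq nat) : path leq x s ->
  scanl addn x (pairmap (fun y z => z - y)%N x s) = s.
Proof. by elim: s x => //= y s IH x /andP[le_xy /IH E]; rewrite subnKC // E. Qed.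

(** Entry k of [s] lies k places from the end of [rev s], so it enters k+1 partial sums: conjugating
    a partition keeps its size. *)
Lemma sumn_scanl_addn_rev (s : seq nat) :
  sumn (scanl addn 0 (rev s)) = (\sum_(k < size s) nth 0 s k * k.+1)%N.
Proof.
elim: s => [|x s IH]; first by rewrite big_ord0.
rewrite rev_cons -cats1 scanl_cat sumn_cat IH /= addn0 big_ord_recl /= muln1.
have -> : foldl addn 0%N (rev s) = (\sum_(k < size s) nth 0 s k)%N.
  rewrite foldl_rev -(big_mkord xpredT (nth 0 s))%N -(big_nth 0%N xpredT id).
  by rewrite -sumnE; elim: s {IH} => //= y s ->; rewrite addnC.
rewrite addnA -big_split /= addnC; congr (_ + _)%N.
by apply: eq_bigr => k _; rewrite -mulnSr.
Qed.

Section SpanningFree.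
Variables (K : fieldType) (W : lmodType K) (I : finType) (E V : I -> W).

(** With a common finite index set, the matrix expressing [E] in [V] is square; freeness of [E]
    makes its rows independent, so it is invertible. *)
Lemma free_of_spanning :
  (forall i, exists c : I -> K, E i = \sum_j c j *: V j) ->
  (forall c : I -> K, \sum_i c i *: E i = 0 -> forall i, c i = 0) ->
  forall c : I -> K, \sum_i c i *: V i = 0 -> forall i, c i = 0.
Proof.
move=> /fin_all_exists[C EV] freeE c cV.
pose M : 'M[K]_#|I| := \matrix_(i, j) C (enum_val i) (enum_val j).
have sumE (u : 'rV[K]_#|I|) :
    \sum_i u 0 (enum_rank i) *: E i = \sum_j (u *m M) 0 (enum_rank j) *: V j.
  under eq_bigr do rewrite EV scaler_sumr.
  rewrite exchange_big /=; apply: eq_bigr => j _.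
  rewrite mxE scaler_suml (reindex _ (onW_bij _ (enum_val_bij I))) /=.
  by apply: eq_bigr => i _; rewrite mxE enum_valK !enum_rankK scalerA.
have free0 (u : 'rV[K]_#|I|) : \sum_j (u *m M) 0 (enum_rank j) *: V j = 0 -> u = 0.
  move=> uMV; apply/rowP => i; rewrite mxE.
  have := freeE (fun i => u 0 (enum_rank i)) (etrans (sumE u) uMV) (enum_val i).
  by rewrite enum_valK.
have Munit : M \in unitmx.
  rewrite -row_free_unit; apply: inj_row_free => u uM; apply: free0.
  by rewrite uM big1 // => j _; rewrite mxE scale0r.
pose u : 'rV[K]_#|I| := \row_j c (enum_val j).
have u0 : u *m invmx M = 0.
  apply: free0; rewrite mulmxKV // -[RHS]cV; apply: eq_bigr => j _.
  by rewrite mxE enum_rankK.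
move=> i; have /rowP/(_ (enum_rank i)) : u = 0 by rewrite -(mulmxKV Munit u) u0 mul0mx.
by rewrite !mxE enum_rankK.
Qed.

End SpanningFree.

(** * Exponents of the e_i as indices of the spanning terms *)

Section MonomialReindexing.
Variable n : nat.
Local Notation m := n./2.

(** Position [2 * j] is the exponent of e_(2j+1), reused for p_(2j+1), which has the same degree. *)
Definition odd_part (a : 'X_{1..n}) : 'X_{1..nodd n} :=
  [multinom nth 0 a (2 * j) | j < nodd n].

Definition even_exponents (a : 'X_{1..n}) : seq nat :=
  mkseq (fun k => nth 0 a (2 * k).+1) m.

(* The exponents of e_2, e_4, ... are the successive differences of the
   index sequence, i.e. the two correspond to conjugate partitions. *)
Definition even_part (a : 'X_{1..n}) : seq nat :=
  scanl addn 0 (rev (even_exponents a)).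

Definition join_parts (g : 'X_{1..nodd n}) (I : seq nat) : 'X_{1..n} :=
  [multinom if odd i then nth 0 (rev (pairmap (fun y z => z - y)%N 0 I)) i./2
            else nth 0 g i./2 | i < n].

Lemma even_part_index a : basis_index n (even_part a).
Proof.
rewrite /basis_index size_scanl size_rev size_mkseq eqxx /=.
exact: path_sorted (scanl_addn_sorted _ _).
Qed.

Lemma nth_join_parts g I k : (k < n)%N ->
  nth 0%N (join_parts g I) k =
  (if odd k then nth 0 (rev (pairmap (fun y z => z - y) 0 I)) k./2 else nth 0 g k./2)%N.
Proof. by move=> lt_kn; rewrite -(mnm_nth 0 _ (Ordinal lt_kn)) mnmE. Qed.

Lemma odd_part_join g I : odd_part (join_parts g I) = g.
Proof.
apply/mnmP => j; rewrite mnmE nth_join_parts; last first.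
  by have := ltn_ord j; rewrite /nodd; lia.
by rewrite (mnm_nth 0%N) mul2n odd_double doubleK.
Qed.

Lemma even_part_join g I : basis_index n I -> even_part (join_parts g I) = I.
Proof.
move=> /andP[/eqP sizeI sortI]; rewrite /even_part.
have -> : even_exponents (join_parts g I) = rev (pairmap (fun y z => z - y)%N 0%N I).
  apply: (@eq_from_nth _ 0%N); rewrite size_mkseq ?size_rev ?size_pairmap // => k lt_km.
  rewrite nth_mkseq // nth_join_parts; last by lia.
  by rewrite /= mul2n odd_double /= uphalf_double.
rewrite revK scanl_addn_pairmap_subn //.
by case: (I) sortI.
Qed.

(** Lets both families be cut off at the same weight, with one index set. *)
Lemma mnmwgt_parts (a : 'X_{1..n}) :
  mnmwgt a = (odd_weight (odd_part a) + 2 * sumn (even_part a))%N.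
Proof.
rewrite sumn_scanl_addn_rev size_mkseq /mnmwgt /odd_weight.
under eq_bigr do rewrite (mnm_nth 0%N).
rewrite (big_ord_parity _ _ (fun i => nth 0 a i * i.+1)%N) /=; congr (_ + _)%N.
  by apply: eq_bigr => j _; rewrite mnmE.
rewrite big_distrr; apply: eq_bigr => k _.
by rewrite nth_mkseq //= mulnCA [(2 * k.+1)%N]mulnS.
Qed.

End MonomialReindexing.

(** * Linear independence and the basis property *)

Section OddBasis.
Variables (F : fieldType) (n : nat).
Hypothesis charF : [pchar F] =i pred0.
Local Notation MP := {mpoly F[n]}.
Local Notation Sn := [tuple mesym n F i.+1 | i < n].

Definition odd_vec (a : 'X_{1..n}) : MP := odd_term F (odd_part a) (even_part a).

(** The total degree never exceeds the weight, so the bounded exponents form a finite type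
    containing all those of weight at most [d]. *)
Definition weight_le (d : nat) : finType :=
  {a : 'X_{1..n < d.+1} | (mnmwgt (bmnm a) <= d)%N}.

Definition wmnm d (b : weight_le d) : 'X_{1..n} := bmnm (val b).

Lemma wmnm_inj d : injective (@wmnm d).
Proof. by move=> a b /val_inj/val_inj. Qed.

Lemma weight_leP d (a : 'X_{1..n}) : (mnmwgt a <= d)%N ->
  exists b : weight_le d, a = wmnm b.
Proof.
move=> le_ad; have lt_ad : (mdeg a < d.+1)%N by rewrite ltnS (leq_trans (leq_mdeg_mnmwgt a)).
by exists (Sub (BMultinom lt_ad) le_ad).
Qed.

Lemma odd_span_weight_le d w x : (w <= d)%N -> odd_span w x ->
  exists c : weight_le d -> F, x = \sum_b c b *: odd_vec (wmnm b).
Proof.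
move=> le_wd Lx; elim: Lx le_wd => [u _|u k y z _ IHy _ IHz le_ud|g I bI le_d].
- by exists (fun=> 0); rewrite big1 // => b _; rewrite scale0r.
- have [[c ->] [c' ->]] := (IHy le_ud, IHz le_ud).
  exists (fun b => k * c b + c' b); rewrite scaler_sumr -big_split /=.
  by apply: eq_bigr => b _; rewrite scalerDl scalerA.
have [|b Eb] := @weight_leP d (join_parts g I).
  by rewrite mnmwgt_parts odd_part_join even_part_join.
exists (fun b' => (b' == b)%:R); rewrite (bigD1 b) //= eqxx scale1r.
rewrite big1 ?addr0 => [|b' /negPf->]; last by rewrite scale0r.
by rewrite -Eb /odd_vec odd_part_join even_part_join.
Qed.

Lemma mesym_monomials_free d (c : weight_le d -> F) :
  \sum_b c b *: ('X_[wmnm b] \mPo Sn) = 0 -> forall b, c b = 0.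
Proof.
move=> c0 b; have : \sum_b c b *: 'X_[wmnm b] = 0 :> MP.
  apply: msym_fundamental_un0; rewrite -[RHS]c0 raddf_sum /=.
  by apply: eq_bigr => a _; rewrite comp_mpolyZ.
move/(congr1 (mcoeff (wmnm b))); rewrite raddf_sum mcoeff0.
rewrite (bigD1 b) //= mcoeffZ mcoeffX eqxx mulr1.
rewrite big1 ?addr0 // => a ne_ab.
by rewrite mcoeffZ mcoeffX (inj_eq (@wmnm_inj d)) (negPf ne_ab) mulr0.
Qed.

(** The counting argument: the free monomials in the e_i of weight at most [d] lie in the span of
    equally many [odd_vec]. *)
Lemma odd_vec_weight_le_free d (c : weight_le d -> F) :
  \sum_b c b *: odd_vec (wmnm b) = 0 -> forall b, c b = 0.
Proof.
apply: free_of_spanning (@mesym_monomials_free d) c => b.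
apply: (@odd_span_weight_le d (mnmwgt (wmnm b))); first exact: (valP b).
apply: symmetric_odd_span => //; first exact: mesym_monomial_sym.
exact: dhomog_XS.
Qed.

Lemma odd_vec_free (s : seq 'X_{1..n}) (c : 'X_{1..n} -> F) : uniq s ->
  \sum_(a <- s) c a *: odd_vec a = 0 -> forall a, a \in s -> c a = 0.
Proof.
move=> uniq_s c0 a a_s; pose d := (\max_(a <- s) mnmwgt a)%N.
have le_sd a' : a' \in s -> (mnmwgt a' <= d)%N.
  by move=> a's; rewrite /d (big_rem a') //= leq_maxl.
have [b Eb] := weight_leP (le_sd a a_s).
suff : \sum_(b : weight_le d) (if wmnm b \in s then c (wmnm b) else 0) *: odd_vec (wmnm b) = 0.
  by move/odd_vec_weight_le_free/(_ b); rewrite -Eb a_s.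
rewrite -[RHS]c0; pose r := [seq wmnm b | b <- enum (weight_le d)].
transitivity (\sum_(a <- r | a \in s) c a *: odd_vec a).
  rewrite /r big_map big_enum_cond [RHS]big_mkcond /=; apply: eq_bigr => b' _.
  by case: ifP; rewrite ?scale0r.
rewrite -big_filter; apply: perm_big; apply: uniq_perm => //.
  by rewrite filter_uniq // map_inj_uniq ?enum_uniq //; exact: wmnm_inj.
move=> a'; rewrite mem_filter; case: (boolP (a' \in s)) => //= a's.
have [b' ->] := weight_leP (le_sd a' a's).
by rewrite map_f ?mem_enum.
Qed.

Lemma symmetric_odd_vec_sum (p : MP) : p \is symmetric ->
  exists (d : nat) (c : weight_le d -> F), p = \sum_b c b *: odd_vec (wmnm b).
Proof.
move=> sp; exists (msize p).
rewrite [X in exists _, X = _](pihomog_partitionE (mf := mdeg) (leqnn (msize p))).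
elim/big_ind: _ => [|x y [c ->] [c' ->]|i _].
- by exists (fun=> 0); rewrite big1 // => b _; rewrite scale0r.
- exists (fun b => c b + c' b); rewrite -big_split /=.
  by apply: eq_bigr => b _; rewrite scalerDl.
apply: (@odd_span_weight_le _ i); first exact: ltnW.
apply: symmetric_odd_span => //; first exact: pihomog_sym.
exact: pihomogP.
Qed.

Lemma symmetric_hbasis_sum (p : MP) : p \is symmetric ->
  exists (S : seq (seq nat)) (a : seq nat -> MP),
    [/\ uniq S, all (basis_index n) S, (forall I, I \in S -> Rodd (a I)) &
        p = \sum_(I <- S) a I * hbasis F n I].
Proof.
move=> /symmetric_odd_vec_sum[d [c ->]].
pose S := undup [seq even_part (wmnm b) | b : weight_le d].
exists S, (fun I => (\sum_(b : weight_le d | even_part (wmnm b) == I)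
                       c b *: 'X_[odd_part (wmnm b)])
                      \mPo odd_psums F n).
split; first exact: undup_uniq.
- by apply/allP => I; rewrite mem_undup => /mapP[b _ ->]; exact: even_part_index.
- by move=> I _; eexists.
under [RHS]eq_bigr do rewrite raddf_sum /= mulr_suml big_mkcond /=.
rewrite exchange_big /=; apply: eq_bigr => b _.
have bS : even_part (wmnm b) \in S by rewrite mem_undup; apply: image_f.
rewrite (bigD1_seq (even_part (wmnm b))) ?undup_uniq //= eqxx big1 ?addr0 => [|I].
  by rewrite comp_mpolyZ -scalerAl.
by rewrite eq_sym => /negPf->.
Qed.

(** Expanding the coefficients gives an [F]-linear relation among [odd_vec] at distinct exponents,
    which forces each polynomial [Q I] representing [a I] to be zero itself. *)
Lemma hbasis_free (S : seq (seq nat)) (a : seq nat -> MP) :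
  uniq S -> all (basis_index n) S -> (forall I, I \in S -> Rodd (a I)) ->
  \sum_(I <- S) a I * hbasis F n I = 0 -> forall I, I \in S -> a I = 0.
Proof.
move=> uniq_S /allP idxS Sodd sum0.
(* Membership sits inside the existential so that the choice function is defined on every list. *)
have aQ I : exists q, I \in S -> a I = q \mPo odd_psums F n.
  by case: (boolP (I \in S)) => [/Sodd[q ->]|_]; [exists q|exists 0].
have {aQ} [Q aQ] := boolp.choice aQ.
pose s := [seq join_parts g J | J <- S, g <- msupp (Q J)].
pose c b := (Q (even_part b))@_(odd_part b).
have uniq_s : uniq s.
  apply: allpairs_uniq_dep => //= -[I g] [I' g'].
  move=> /allpairsPdep[J [k [JS _ [-> ->]]]] /allpairsPdep[J' [k' [JS' _ [-> ->]]]] /= E.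
  have := congr1 (@even_part n) E; rewrite !even_part_join ?idxS // => EJ.
  by have := congr1 (@odd_part n) E; rewrite !odd_part_join EJ => ->.
have c0 : \sum_(b <- s) c b *: odd_vec b = 0.
  rewrite -[RHS]sum0 big_allpairs_dep /=; apply: eq_big_seq => I IS.
  rewrite aQ // {2}[Q I]mpolyE raddf_sum mulr_suml /=; apply: eq_bigr => g _.
  rewrite /c /odd_vec odd_part_join even_part_join ?idxS //.
  by rewrite comp_mpolyZ -scalerAl.
move=> I IS; rewrite aQ //; suff -> : Q I = 0 by rewrite raddf0.
apply/mpolyP => g; rewrite mcoeff0; apply/eqP; rewrite mcoeff_eq0; apply/negP => g_supp.
have gs : join_parts g I \in s by apply/allpairsPdep; exists I, g.
have := odd_vec_free uniq_s c0 gs.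
rewrite /c odd_part_join even_part_join ?idxS // => /eqP.
by rewrite mcoeff_eq0 g_supp.
Qed.

End OddBasis.

Unset Implicit Arguments.

(* R_n is a free R_n^odd-module with basis
   { h_{2i_1} ... h_{2i_{n'}} | 0 <= i_1 <= ... <= i_{n'} }:
   (1) every symmetric polynomial is an R_n^odd-linear combination of finitely
       many distinct basis elements, and
   (2) the basis elements are R_n^odd-linearly independent. *)
Theorem mainTheorem4 (R : realType) (n : nat) (hn : (1 <= n)%N) :
  (forall p : {mpoly R[i][n]}, p \is symmetric ->
     exists (S : seq (seq nat)) (a : seq nat -> {mpoly R[i][n]}),
       [/\ uniq S, all (@basis_index n) S,
           (forall I, I \in S -> Rodd (a I)) &
           p = \sum_(I <- S) a I * hbasis R[i] n I])
  /\
  (forall (S : seq (seq nat)) (a : seq nat -> {mpoly R[i][n]}),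
     uniq S -> all (@basis_index n) S ->
     (forall I, I \in S -> Rodd (a I)) ->
     \sum_(I <- S) a I * hbasis R[i] n I = 0 ->
     forall I, I \in S -> a I = 0).
Proof.
have charC : [pchar R[i]] =i pred0 := Num.Theory.pchar_num R[i].
split=> [p|S a]; first exact: symmetric_hbasis_sum.
exact: hbasis_free.
Qed.
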